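(* As formal power series in $q$, \begin{align*} \sum_{n=0}^{\infty} S(4n)q^n & = \frac{f_4^3f_6^7}{f_1f_2^2f_3^5f_{12}^3}, & \sum_{n=0}^{\infty} S(4n+1)q^n & = \frac{f_2f_4f_{6}^4}{f_1^2f_3^4f_{12}}, \\ \sum_{n=0}^{\infty} S(4n+2)q^n & = \frac{f_2^4f_6f_{12}}{f_1^3f_3^3f_4}, & \sum_{n=0}^{\infty} S(4n+3)q^n & = \frac{f_2^7f_{12}^3}{f_1^4f_3^2f_4^3f_6^2}. \end{align*}
   Context: Let $(a;q)_\infty:=\prod_{k\geq 0}(1-aq^k)$ and, for a positive integer $r$, $f_r:=(q^r;q^r)_\infty=\prod_{k\geq1}(1-q^{rk})$. The function $S(n)$ (the number of overpartitions of $n$ of Schur-type, in the sense of Broudy and Lovejoy) is defined by the generating function $$\sum_{n=0}^{\infty} S(n)q^n = \frac{1}{(q;q^6)_\infty(q^5;q^6)_\infty(q^6;q^6)_\infty}.$$ *)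

(* Defs.v *)
From HB Require Import structures.
From mathcomp Require Import all_boot all_order all_algebra.
From mathcomp Require Import boolp.

Set Implicit Arguments.
Unset Strict Implicit.
Unset Printing Implicit Defensive.

Import GRing.Theory.
Local Open Scope ring_scope.

(* Formal power series sum_n a_n q^n, represented by n |-> a_n. The type is a
   record, and not nat -> R, because functions into a ring carry the pointwise
   product. *)
Record fps (R : Type) := FPS { fps_coef :> nat -> R }.

HB.instance Definition _ (R : Type) := gen_eqMixin (fps R).
HB.instance Definition _ (R : Type) := gen_choiceMixin (fps R).

Lemma fpsP (R : Type) (a b : fps R) : a =1 b <-> a = b.
Proof.
by split=> [|-> //]; case: a b => [a] [b] /= ab; congr FPS; apply/funext.
Qed.

Section Zmod.
Variable R : zmodType.
Implicit Types a b c x : fps R.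

Definition fps_zero : fps R := FPS (fun=> 0).
Definition fps_opp a : fps R := FPS (fun n => - a n).
Definition fps_add a b : fps R := FPS (fun n => a n + b n).

Fact fps_addA : associative fps_add.
Proof. by move=> a b c; apply/fpsP => n /=; rewrite addrA. Qed.
Fact fps_addC : commutative fps_add.
Proof. by move=> a b; apply/fpsP => n /=; rewrite addrC. Qed.
Fact fps_add0 : left_id fps_zero fps_add.
Proof. by move=> a; apply/fpsP => n /=; rewrite add0r. Qed.
Fact fps_addN : left_inverse fps_zero fps_opp fps_add.
Proof. by move=> a; apply/fpsP => n /=; rewrite addNr. Qed.

HB.instance Definition _ := GRing.isZmodule.Build (fps R)
  fps_addA fps_addC fps_add0 fps_addN.

Lemma fps_coef0 n : (0 : fps R) n = 0. Proof. by []. Qed.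
Lemma fps_coefD a b n : (a + b) n = a n + b n. Proof. by []. Qed.
Lemma fps_coefN a n : (- a) n = - a n. Proof. by []. Qed.
Lemma fps_coefB a b n : (a - b) n = a n - b n. Proof. by []. Qed.

Lemma fps_coef_sum (I : Type) (r : seq I) (P : pred I) (F : I -> fps R) n :
  (\sum_(i <- r | P i) F i) n = \sum_(i <- r | P i) F i n.
Proof. by elim/big_rec2: _ => // i y1 y2 _ <-. Qed.

End Zmod.

Section Ring.
Variable R : comNzRingType.
Implicit Types a b c x : fps R.

Definition fps_one : fps R := FPS (fun n => (n == 0)%:R).
Definition fps_mul a b : fps R :=
  FPS (fun n => \sum_(i < n.+1) a i * b (n - i)%N).

Let trunc m a : {poly R} := \poly_(i < m) a i.

Let fps_mul_trunc a b m n :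
  (n < m)%N -> fps_mul a b n = (trunc m a * trunc m b)`_n.
Proof.
move=> nm; rewrite coefM; apply: eq_bigr => i _; rewrite !coef_poly.
have im : (i < m)%N by apply: leq_ltn_trans nm; rewrite -ltnS.
by rewrite im (leq_ltn_trans (leq_subr _ _) nm).
Qed.

Fact fps_mulC : commutative fps_mul.
Proof.
by move=> a b; apply/fpsP => n; rewrite !(fps_mul_trunc _ _ (ltnSn n)) mulrC.
Qed.

Let fps_mulE3 a b c n : fps_mul a (fps_mul b c) n =
  (trunc n.+1 a * (trunc n.+1 b * trunc n.+1 c))`_n.
Proof.
rewrite coefM; apply: eq_bigr => i _; rewrite coef_poly ltn_ord; congr (_ * _).
by rewrite -fps_mul_trunc // ltnS leq_subr.
Qed.

Fact fps_mulA : associative fps_mul.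
Proof.
move=> a b c; apply/fpsP => n.
rewrite [fps_mul (fps_mul a b) c]fps_mulC !fps_mulE3.
by rewrite mulrA [in RHS]mulrC.
Qed.

Fact fps_mul1 : left_id fps_one fps_mul.
Proof.
move=> a; apply/fpsP => n /=.
rewrite big_ord_recl /= subn0 mul1r big1 ?addr0 // => i _.
by rewrite mul0r.
Qed.

Fact fps_mulDl : left_distributive fps_mul +%R.
Proof.
move=> a b c; apply/fpsP => n /=.
by rewrite -big_split; apply: eq_bigr => i _; rewrite mulrDl.
Qed.

Fact fps_one_neq0 : fps_one != 0.
Proof.
by apply/eqP => /(congr1 (fun a : fps R => a 0%N))/eqP; rewrite oner_eq0.
Qed.

HB.instance Definition _ := GRing.Zmodule_isComNzRing.Build (fps R)
  fps_mulA fps_mulC fps_mul1 fps_mulDl fps_one_neq0.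

Definition fps_X : fps R := FPS (fun n => (n == 1)%:R).

Lemma fps_coef1 n : (1 : fps R) n = (n == 0)%:R. Proof. by []. Qed.
Lemma fps_coefM a b n : (a * b) n = \sum_(i < n.+1) a i * b (n - i)%N.
Proof. by []. Qed.
Lemma fps_coef0M a b : (a * b) 0%N = a 0%N * b 0%N.
Proof. by rewrite fps_coefM big_ord1. Qed.

Lemma fps_coefX_small a k n : a 0%N = 0 -> (n < k)%N -> (a ^+ k) n = 0.
Proof.
move=> a0; elim: k n => // k IH n nk.
rewrite exprS fps_coefM big_ord_recl a0 mul0r add0r big1 // => i _.
by rewrite IH ?mulr0 //= /bump /=; case: n i nk => [[]//|n] i nk; rewrite subSS
  (leq_ltn_trans (leq_subr _ _)).
Qed.

Lemma fps_coefMX_small a b k n :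
  a 0%N = 0 -> (n < k)%N -> (b * a ^+ k) n = 0.
Proof.
move=> a0 nk; rewrite fps_coefM big1 // => i _.
by rewrite fps_coefX_small ?mulr0 // (leq_ltn_trans (leq_subr _ _)).
Qed.

(* (a; x)_oo = prod_(k >= 0) (1 - a x^k), for x without constant term. The
   factors with k > n do not affect the coefficient of q^n, so this is the
   coefficientwise limit of the partial products: see qpoch_lim. *)
Definition qpoch a x : fps R :=
  FPS (fun n => (\prod_(k < n.+1) (1 - a * x ^+ k)) n).

Lemma qpoch_lim a x n m : x 0%N = 0 -> (n < m)%N ->
  (\prod_(k < m) (1 - a * x ^+ k)) n = qpoch a x n.
Proof.
move=> x0; elim: m => // m IH; rewrite ltnS leq_eqVlt => /predU1P[-> //|nm].
have -> : \prod_(k < m.+1) (1 - a * x ^+ k)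
    = \prod_(k < m) (1 - a * x ^+ k) * (1 - a * x ^+ m) by rewrite big_ord_recr.
rewrite mulrBr mulr1 fps_coefB IH //.
by rewrite mulrA fps_coefMX_small // subr0.
Qed.

Definition euler_f (r : nat) : fps R := qpoch (fps_X ^+ r) (fps_X ^+ r).

End Ring.

Section UnitRing.
Variable R : comUnitRingType.
Implicit Types a b x : fps R.

Definition fps_unit : {pred fps R} := fun a => a 0%N \is a GRing.unit.

(* With u := 1 - a / a_0, the inverse is a_0^-1 * sum_k u^k; since u_0 = 0 the
   terms with k > n do not affect the coefficient of q^n. *)
Definition fps_inv a : fps R :=
  if a \in fps_unit then
    let u := 1 - FPS (fun n => (a 0%N)^-1 * a n) in
    FPS (fun n => (a 0%N)^-1 * (\sum_(k < n.+1) u ^+ k) n)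
  else a.

Fact fps_mulV : {in fps_unit, left_inverse 1 fps_inv *%R}.
Proof.
move=> a ua; have ua0 : a 0%N \is a GRing.unit := ua.
rewrite /fps_inv ua; set v := FPS (fun n => (a 0%N)^-1 * a n).
set u := 1 - v.
have u0 : u 0%N = 0 by rewrite fps_coefB /= mulVr // subrr.
have stab n m : (n < m)%N ->
    (\sum_(k < m) u ^+ k) n = (\sum_(k < n.+1) u ^+ k) n.
  elim: m => // m IH; rewrite ltnS leq_eqVlt => /predU1P[-> //|nm].
  have -> : \sum_(k < m.+1) u ^+ k = \sum_(k < m) u ^+ k + u ^+ m.
    by rewrite big_ord_recr.
  by rewrite fps_coefD IH // fps_coefX_small // addr0.
apply/fpsP => n.
have -> : (FPS (fun n => (a 0%N)^-1 * (\sum_(k < n.+1) u ^+ k) n) * a) n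
    = ((\sum_(k < n.+1) u ^+ k) * v) n.
  rewrite !fps_coefM; apply: eq_bigr => i _ /=.
  by rewrite [RHS]mulrCA mulrA (stab i n.+1).
have -> : v = 1 - u by rewrite /u opprB addrC subrK.
rewrite mulrC.
have -> : (1 - u) * \sum_(k < n.+1) u ^+ k = 1 - u ^+ n.+1.
  by rewrite -opprB mulNr -subrX1 opprB.
by rewrite fps_coefB fps_coefX_small // subr0.
Qed.

Fact fps_unitPl a b : b * a = 1 -> a \in fps_unit.
Proof.
move=> /(congr1 (fun c : fps R => c 0%N)); rewrite fps_coef0M fps_coef1 eqxx.
by move=> ba; apply/unitrPr; exists (b 0%N); rewrite mulrC.
Qed.

Fact fps_inv_out : {in [predC fps_unit], fps_inv =1 id}.
Proof. by move=> a; rewrite inE /fps_inv => /negbTE ->. Qed.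

HB.instance Definition _ := GRing.ComNzRing_hasMulInverse.Build (fps R)
  fps_mulV fps_unitPl fps_inv_out.

Lemma fps_unitE a : (a \is a GRing.unit) = (a 0%N \is a GRing.unit).
Proof. by []. Qed.

Lemma qpoch_unit a x : a 0%N = 0 -> qpoch a x \is a GRing.unit.
Proof.
by move=> a0; rewrite fps_unitE /= big_ord1 fps_coefB fps_coef0M a0 mul0r subr0
  unitr1.
Qed.

Lemma euler_f_unit r : (0 < r)%N -> euler_f R r \is a GRing.unit.
Proof. by move=> r0; rewrite qpoch_unit // fps_coefX_small. Qed.

End UnitRing.

Notation "'q" := (fps_X int) : ring_scope.
Notation "''f_' r" := (euler_f int r)
  (at level 8, r at level 2, format "''f_' r") : ring_scope.

(* The number of overpartitions of n of Schur type, valued in int. *)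
Definition overS (n : nat) : int :=
  ((qpoch 'q ('q ^+ 6) * qpoch ('q ^+ 5) ('q ^+ 6)
    * qpoch ('q ^+ 6) ('q ^+ 6))^-1 : fps int) n.

Lemma overS_gf : FPS overS = (qpoch 'q ('q ^+ 6) * qpoch ('q ^+ 5) ('q ^+ 6)
    * qpoch ('q ^+ 6) ('q ^+ 6))^-1.
Proof. exact/fpsP. Qed.

Lemma overS_gf_unit : qpoch 'q ('q ^+ 6) * qpoch ('q ^+ 5) ('q ^+ 6)
    * qpoch ('q ^+ 6) ('q ^+ 6) \is a GRing.unit.
Proof. by rewrite !unitrM !qpoch_unit ?fps_coefX_small. Qed.

(* Main.v *)
Require Import Defs.
From mathcomp Require Import all_boot all_order all_algebra.
From mathcomp Require Import zify ring.

Set Implicit Arguments.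
Unset Strict Implicit.
Unset Printing Implicit Defensive.

Import GRing.Theory.
Local Open Scope ring_scope.

(* Write A = (q, q^5, q^6; q^6)_oo, so that sum_n S(n) q^n = 1 / A. By the
   Jacobi triple product A = sum_j (-1)^j q^(3 j^2 - 2 j), and separating even
   from odd j gives A = P(q^4) - q Q(q^4) with P = sum_j q^(3 j^2 - j) and
   Q = sum_j q^(3 j^2 + 2 j) = A(-q). Hence
     1 / A = sum_(r < 4) q^r (P^(3-r) Q^r / D)(q^4),   D = P^4 - q Q^4,
   which is the 4-dissection. The triple product turns P and Q into quotients of
   the f_r. So is D: A(q) A(-q) = B(q^2) with B(q) = P(q^2)^2 - q Q(q^2)^2, and
   B(q) B(-q) = D(q^2), while f_r(-q) is an explicit quotient of the f_r.

   The triple product itself is the limit, modulo each power of q, of its finite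
   form with Gaussian binomial coefficients. *)

(** * Congruence of power series modulo q^N, and infinite products *)

Section Congruence.
Variable R : comNzRingType.
Implicit Types a b c d x y : fps R.

Definition eqmodX N a b := forall n, (n < N)%N -> a n = b n.

Lemma eqmodX_all a b : (forall N, eqmodX N a b) -> a = b.
Proof. by move=> ab; apply/fpsP => n; exact: (ab n.+1). Qed.

Lemma eqmodX_sym N a b : eqmodX N a b -> eqmodX N b a.
Proof. by move=> ab n nN; rewrite ab. Qed.

Lemma eqmodX_trans N b a c : eqmodX N a b -> eqmodX N b c -> eqmodX N a c.
Proof. by move=> ab bc n nN; rewrite ab ?bc. Qed.

Lemma eqmodX_leq M N a b : (M <= N)%N -> eqmodX N a b -> eqmodX M a b.
Proof. by move=> MN ab n nM; apply: ab; apply: leq_trans MN. Qed.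

Lemma eqmodXD N a b c d :
  eqmodX N a b -> eqmodX N c d -> eqmodX N (a + c) (b + d).
Proof. by move=> ab cd n nN; rewrite !fps_coefD ab ?cd. Qed.

Lemma eqmodXM N a b c d :
  eqmodX N a b -> eqmodX N c d -> eqmodX N (a * c) (b * d).
Proof.
move=> ab cd n nN; rewrite !fps_coefM; apply: eq_bigr => i _.
by rewrite ab ?cd //; move: (ltn_ord i); lia.
Qed.

Lemma eqmodX_sum N (I : Type) (r : seq I) (P : pred I) (F G : I -> fps R) :
  (forall i, P i -> eqmodX N (F i) (G i)) ->
  eqmodX N (\sum_(i <- r | P i) F i) (\sum_(i <- r | P i) G i).
Proof.
by move=> FG; elim/big_ind2: _ => // a b c d; exact: eqmodXD.
Qed.

Lemma eqmodX_exp0 k N a : a 0%N = 0 -> (N <= k)%N -> eqmodX N (a ^+ k) 0.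
Proof. by move=> a0 Nk n nN; apply: fps_coefX_small => //; apply: leq_trans Nk. Qed.

(** In each term a_i b_(n - i) with n < M + N, either i < M or n - i < N. *)
Lemma eqmodX_mul0 M N a b :
  eqmodX M a 0 -> eqmodX N b 0 -> eqmodX (M + N) (a * b) 0.
Proof.
move=> a0 b0 n nMN; rewrite fps_coefM big1 // => i _.
have [iM|Mi] := ltnP i M; first by rewrite a0 ?mul0r.
by rewrite (b0 (n - i)%N) ?mulr0 //; move: (ltn_ord i); lia.
Qed.

Lemma eqmodX_qpoch N M a x : x 0%N = 0 -> (N <= M)%N ->
  eqmodX N (qpoch a x) (\prod_(k < M) (1 - a * x ^+ k)).
Proof. by move=> x0 NM n nN; rewrite qpoch_lim // (leq_trans nN). Qed.

Lemma fps_coefXn m n : (fps_X R ^+ m) n = (n == m)%:R.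
Proof.
elim: m n => [|m IH] n; first by rewrite fps_coef1.
rewrite exprS fps_coefM; case: n => [|n].
  by rewrite big_ord1 /= mul0r.
rewrite big_ord_recl /= mul0r add0r big_ord_recl /= mul1r subSS subn0 IH.
by rewrite big1 ?addr0 // => i _; rewrite mul0r.
Qed.

(** The factors 1 - a x^k are sorted by the residue j of k modulo m. *)
Lemma qpoch_split m a x : (0 < m)%N -> x 0%N = 0 ->
  qpoch a x = \prod_(j < m) qpoch (a * x ^+ j) (x ^+ m).
Proof.
move=> m0 x0; apply: eqmodX_all => N.
(* Cutting at m * N factors leaves exactly N of them in each residue class. *)
have NM : (N <= m * N)%N by rewrite leq_pmull.
apply: (eqmodX_trans (eqmodX_qpoch _ x0 NM)).
have -> : \prod_(k < m * N) (1 - a * x ^+ k)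
    = \prod_(j < m) \prod_(k < N) (1 - a * x ^+ j * (x ^+ m) ^+ k).
  elim: (N) => [|M IH].
    by rewrite muln0 big_ord0 big1 // => j _; rewrite big_ord0.
  rewrite mulnS addnC big_split_ord /= IH -big_split /=.
  apply: eq_bigr => j _; rewrite big_ord_recr /=; congr (_ * (1 - _)).
  by rewrite exprD -exprM mulrA mulrAC.
apply: eqmodX_sym.
elim/big_ind2: _ => // [a1 b c d|j _]; first exact: eqmodXM.
by apply: eqmodX_qpoch => //; rewrite fps_coefX_small.
Qed.

Lemma qpochN a x : x 0%N = 0 ->
  qpoch a x * qpoch (- a) x = qpoch (a ^+ 2) (x ^+ 2).
Proof.
move=> x0; apply: eqmodX_all => N.
have x20 : (x ^+ 2) 0%N = 0 by rewrite fps_coefX_small.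
apply: eqmodX_trans (eqmodX_sym (eqmodX_qpoch _ x20 (leqnn N))).
apply: eqmodX_trans (eqmodXM (eqmodX_qpoch _ x0 (leqnn N))
                             (eqmodX_qpoch _ x0 (leqnn N))) _.
rewrite -big_split /=.
suff -> : \prod_(i < N) ((1 - a * x ^+ i) * (1 - - a * x ^+ i))
        = \prod_(k < N) (1 - a ^+ 2 * (x ^+ 2) ^+ k) by [].
by apply: eq_bigr => i _; rewrite -exprM mulnC exprM; ring.
Qed.

End Congruence.

(** * Substitution of a series without constant term *)

Section Substitution.
Variable R : comNzRingType.
Implicit Types a b x y : fps R.

(* a(x), meaningful when x has no constant term: the terms with k > n then do
   not affect the coefficient of q^n. *)
Definition fps_comp x a : fps R :=
  FPS (fun n => \sum_(k < n.+1) a k * (x ^+ k) n).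

Let cst (c : R) : fps R := FPS (fun n => c * (n == 0)%:R).

Let coef_cstM c a n : (cst c * a) n = c * a n.
Proof.
rewrite fps_coefM big_ord_recl /= mulr1 subn0 big1 ?addr0 // => i _.
by rewrite mulr0 mul0r.
Qed.

Let cstM c d : cst (c * d) = cst c * cst d.
Proof. by apply/fpsP => n; rewrite coef_cstM /= mulrA. Qed.

Let cst_sum (I : Type) (r : seq I) (P : pred I) (F : I -> R) :
  cst (\sum_(i <- r | P i) F i) = \sum_(i <- r | P i) cst (F i).
Proof. by apply/fpsP => n; rewrite fps_coef_sum /= mulr_suml. Qed.

(** A truncation with coefficients in [fps R], so that substituting x becomes polynomial evaluation
    at x, which is known to be multiplicative. *)
Let trunc N a : {poly fps R} := \poly_(k < N) cst (a k).

Let compE N x a : x 0%N = 0 -> eqmodX N (fps_comp x a) (trunc N a).[x].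
Proof.
move=> x0 n nN /=; rewrite horner_poly fps_coef_sum.
under [RHS]eq_bigr do rewrite coef_cstM.
rewrite -(subnKC nN) big_split_ord /= [X in _ + X]big1 ?addr0 // => i _.
by rewrite fps_coefX_small ?mulr0 //; lia.
Qed.

(** The monomials of p - r have degree at least N, and x^N vanishes modulo q^N. *)
Let horner_eq N (p r : {poly fps R}) x : x 0%N = 0 ->
  (forall i, (i < N)%N -> p`_i = r`_i) -> eqmodX N p.[x] r.[x].
Proof.
move=> x0 pr; rewrite -[p](subrK r) hornerD -[X in eqmodX _ _ X]add0r.
apply: eqmodXD => //; rewrite horner_coef.
move=> n nN; rewrite fps_coef_sum big1 // => i _; have [iN|Ni] := ltnP i N.
  by rewrite coefB pr // subrr mul0r.
by rewrite fps_coefMX_small // (leq_trans nN).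
Qed.

Lemma fps_compM x a b : x 0%N = 0 ->
  fps_comp x (a * b) = fps_comp x a * fps_comp x b.
Proof.
move=> x0; apply: eqmodX_all => N.
apply: eqmodX_trans (@compE N _ _ x0) _; apply: eqmodX_sym.
apply: eqmodX_trans (eqmodXM (@compE N _ _ x0) (@compE N _ _ x0)) _.
rewrite -hornerM; apply: horner_eq => // i iN.
rewrite coefM coef_poly iN fps_coefM cst_sum; apply: eq_bigr => j _.
by rewrite !coef_poly cstM !ifT //; move: (ltn_ord j); lia.
Qed.

Lemma fps_compD x a b : fps_comp x (a + b) = fps_comp x a + fps_comp x b.
Proof.
by apply/fpsP => n /=; rewrite -big_split; apply: eq_bigr => i _; rewrite mulrDl.
Qed.

Lemma fps_compN x a : fps_comp x (- a) = - fps_comp x a.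
Proof.
by apply/fpsP => n /=; rewrite -sumrN; apply: eq_bigr => i _; rewrite mulNr.
Qed.

Lemma fps_compB x a b : fps_comp x (a - b) = fps_comp x a - fps_comp x b.
Proof. by rewrite fps_compD fps_compN. Qed.

Lemma fps_comp1 x : fps_comp x 1 = 1.
Proof.
apply/fpsP => n /=; rewrite big_ord_recl mul1r expr0 big1 ?addr0 // => i _.
by rewrite mul0r.
Qed.

Lemma fps_compXn x a k : x 0%N = 0 -> fps_comp x (a ^+ k) = fps_comp x a ^+ k.
Proof.
by move=> x0; elim: k => [|k IH]; rewrite ?fps_comp1 // !exprS fps_compM ?IH.
Qed.

Lemma fps_compX x : x 0%N = 0 -> fps_comp x (fps_X R) = x.
Proof.
move=> x0; apply/fpsP => -[|n] /=; first by rewrite big_ord1 mul0r x0.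
rewrite big_ord_recl /= mul0r add0r big_ord_recl /= mul1r expr1.
by rewrite big1 ?addr0 // => i _; rewrite mul0r.
Qed.

Lemma fps_comp_coef0 x a : fps_comp x a 0%N = a 0%N.
Proof. by rewrite /= big_ord1 fps_coef1 mulr1. Qed.

Lemma eqmodX_comp N x a b : eqmodX N a b -> eqmodX N (fps_comp x a) (fps_comp x b).
Proof.
move=> ab n nN; apply: eq_bigr => i _; rewrite ab //.
by apply: leq_trans nN; rewrite ltn_ord.
Qed.

Lemma fps_comp_qpoch x a y : x 0%N = 0 -> y 0%N = 0 ->
  fps_comp x (qpoch a y) = qpoch (fps_comp x a) (fps_comp x y).
Proof.
move=> x0 y0; apply: eqmodX_all => N.
apply: eqmodX_trans (eqmodX_comp x (eqmodX_qpoch _ y0 (leqnn N))) _.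
apply: eqmodX_sym; apply: eqmodX_trans (eqmodX_qpoch _ _ (leqnn N)) _.
  by rewrite fps_comp_coef0.
rewrite (big_morph (fps_comp x) (fun a b => fps_compM a b x0) (fps_comp1 x)).
have -> // : \prod_(k < N) (1 - fps_comp x a * fps_comp x y ^+ k) =
  \prod_(k < N) fps_comp x (1 - a * y ^+ k).
by apply: eq_bigr => i _; rewrite fps_compB fps_comp1 fps_compM ?fps_compXn.
Qed.

Lemma fps_comp_coefXn k a n r : (r < k)%N ->
  fps_comp (fps_X R ^+ k) a (k * n + r)%N = a n *+ (r == 0)%N.
Proof.
move=> rk /=; have k0 : (0 < k)%N by lia.
under eq_bigr do rewrite -exprM fps_coefXn.
have nk : (n < (k * n + r).+1)%N.
  by rewrite ltnS (leq_trans (leq_pmull n k0)) ?leq_addr.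
rewrite (bigD1 (Ordinal nk)) //= -[X in _ == X]addn0 eqn_add2l.
rewrite big1 ?addr0 => [|i ni]; first by case: eqP; rewrite ?mulr1 ?mulr0.
suff -> : ((k * n + r)%N == (k * i)%N) = false by rewrite mulr0.
apply/negbTE; apply: contra ni => /eqP e; apply/eqP/val_inj => /=.
have := congr1 (fun m => m %/ k)%N e.
by rewrite mulKn // divnDl ?dvdn_mulr // mulKn // divn_small // addn0.
Qed.

(** The coefficients of a reappear at the multiples of k. This lets an identity in q^2 descend to
    one in q. *)
Lemma fps_comp_Xn_inj k : (0 < k)%N -> injective (fps_comp (fps_X R ^+ k)).
Proof.
move=> k0 a b ab; apply/fpsP => n.
have := congr1 (fun c : fps R => c (k * n + 0)%N) ab.
by rewrite !fps_comp_coefXn // !mulr1n.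
Qed.

Lemma fps_coefXnM a k n : (fps_X R ^+ k * a) (n + k)%N = a n.
Proof.
rewrite fps_coefM.
have kn : (k < (n + k).+1)%N by lia.
rewrite (bigD1 (Ordinal kn)) //= fps_coefXn eqxx mul1r addnK.
rewrite big1 ?addr0 // => i ik; rewrite fps_coefXn.
suff -> : (nat_of_ord i == k) = false by rewrite mul0r.
by apply/negbTE; apply: contra ik => /eqP e; apply/eqP/val_inj.
Qed.

End Substitution.

(** * Gaussian binomial coefficients *)

Section GaussianBinomial.
Variables (R : comNzRingType) (x : R).

(** Pascal's rule serves as definition, since the quotient formula would divide by elements 1 - x^k
    that need not be units. *)
Fixpoint qbin n k : R :=
  match n, k with
  | _, 0 => 1
  | 0, _.+1 => 0
  | n'.+1, k'.+1 => qbin n' k' + x ^+ k * qbin n' k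
  end.

(** The finite product (x; x)_n. *)
Definition qfact n : R := \prod_(k < n) (1 - x ^+ k.+1).

Lemma qbin0 n : qbin n 0 = 1. Proof. by case: n. Qed.

Lemma qbinS n k : qbin n.+1 k.+1 = qbin n k + x ^+ k.+1 * qbin n k.+1.
Proof. by []. Qed.

Lemma qbin_small n k : (n < k)%N -> qbin n k = 0.
Proof.
elim: n k => [|n IH] [|k] //= nk.
by rewrite !IH ?mulr0 ?addr0 // ltnW.
Qed.

(** The second Pascal rule, dual to [qbinS]: each rule handles the growth of one of the two products
    in the finite triple product. *)
Lemma qbinS' n k : (k <= n)%N ->
  qbin n.+1 k.+1 = x ^+ (n - k) * qbin n k + qbin n k.+1.
Proof.
elim: n k => [|n IH] [|k] // kn.
- by rewrite /= expr1 mulr0 expr0 mul1r.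
- rewrite qbinS [in LHS](IH 0%N) // qbinS !qbin0 !subn0 !exprS; ring.
rewrite qbinS [in LHS](IH k) // subSS.
have [nk|kn'] := leqP n k.
  have -> : k = n by lia.
  by rewrite subnn (@qbin_small n.+1 n.+2) // qbinS (@qbin_small n n.+1) //; ring.
rewrite [in LHS](IH k.+1) // [qbin n.+1 k.+1 in RHS]qbinS [qbin n.+1 k.+2]qbinS.
have -> : (n - k = (n - k.+1).+1)%N by lia.
rewrite !exprS; ring.
Qed.

Lemma qfact0 : qfact 0 = 1. Proof. exact: big_ord0. Qed.

Lemma qfactS n : qfact n.+1 = qfact n * (1 - x ^+ n.+1).
Proof. by rewrite /qfact big_ord_recr. Qed.

Lemma qbin_qfact k l : qbin (k + l) k * (qfact k * qfact l) = qfact (k + l).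
Proof.
move: {2}(k + l)%N (leqnn (k + l)) => n; elim: n k l => [|n IH] k l.
  by case: k l => [|k] [|l] // _; rewrite qfact0 !mulr1.
case: k => [|k]; first by rewrite qbin0 qfact0 !mul1r.
case: l => [|l] kl.
  move: (IH k 0%N ltac:(lia)); rewrite !addn0 qbinS (@qbin_small k k.+1) //.
  by rewrite qfact0 mulr0 addr0 !mulr1 qfactS mulrA => ->.
rewrite addSn qbinS.
have H1 := IH k l.+1 ltac:(lia); have H2 := IH k.+1 l ltac:(lia).
rewrite [in RHS]qfactS; rewrite (addSnnS k l) in H2.
have -> : x ^+ (k + l.+1).+1 = x ^+ k.+1 * x ^+ l.+1 by rewrite -exprD addSn.
(* This matches the splitting 1 - x^(k+l+2) = (1 - x^(k+1)) + x^(k+1) (1 - x^(l+1)) of the last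
   factor. *)
transitivity ((qbin (k + l.+1) k * (qfact k * qfact l.+1)) * (1 - x ^+ k.+1)
  + x ^+ k.+1 * (1 - x ^+ l.+1) * (qbin (k + l.+1) k.+1 * (qfact k.+1 * qfact l))).
  rewrite !qfactS; ring.
rewrite H1 H2; ring.
Qed.

End GaussianBinomial.

Arguments qbin : simpl never.

Lemma bin2S n : ('C(n.+1, 2) = 'C(n, 2) + n)%N.
Proof. by rewrite binS bin1 addnC. Qed.

(** * The finite Jacobi triple product and the parity of theta terms *)

Section FiniteTripleProduct.
Variable R : comNzRingType.
Implicit Types a b c : R.

(* With j = i - n this is a^(j(j+1)/2) b^(j(j-1)/2): for each sign of j the
   truncated subtractions kill the unwanted binomials. *)
Definition theta_term a b n i : R :=
  a ^+ ('C((i - n).+1, 2) + 'C(n - i, 2))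
  * b ^+ ('C(i - n, 2) + 'C((n - i).+1, 2)).

Lemma theta_termSS a b n i : theta_term a b n.+1 i.+1 = theta_term a b n i.
Proof. by rewrite /theta_term !subSS. Qed.

(** With j = i - n, the terms of index j + 1 and j have ratio a (a b)^j, and m + n - i = m - j. The
    case split is on the sign of j. *)
Lemma theta_term_mula a b m n i : (i <= m + n)%N ->
  a * (a * b) ^+ m * theta_term a b n i
  = (a * b) ^+ (m + n - i) * theta_term a b n i.+1.
Proof.
move=> imn; rewrite /theta_term !exprMn.
have mul4 e1 e2 e3 e4 : a ^+ e1 * b ^+ e2 * (a ^+ e3 * b ^+ e4)
    = a ^+ (e1 + e3) * b ^+ (e2 + e4) by rewrite !exprD; ring.
rewrite [a * (_ * _)]mulrA -exprS !mul4.
have [ni|ni] := leqP n i.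
  have -> : (n - i.+1 = 0)%N by lia.
  have -> : (n - i = 0)%N by lia.
  have -> : (i.+1 - n = (i - n).+1)%N by lia.
  rewrite !bin2S; congr (_ ^+ _ * _ ^+ _); lia.
have -> : (n - i = (n - i.+1).+1)%N by lia.
have -> : (i.+1 - n = 0)%N by lia.
have -> : (i - n = 0)%N by lia.
rewrite !bin2S; congr (_ ^+ _ * _ ^+ _); lia.
Qed.

Lemma theta_term_mulb a b n i :
  b * (a * b) ^+ n * theta_term a b n i = (a * b) ^+ i * theta_term a b n.+1 i.
Proof.
rewrite /theta_term !exprMn.
have mul4 e1 e2 e3 e4 : a ^+ e1 * b ^+ e2 * (a ^+ e3 * b ^+ e4)
    = a ^+ (e1 + e3) * b ^+ (e2 + e4) by rewrite !exprD; ring.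
rewrite [b * (_ * _)]mulrCA -exprS !mul4.
have [ni|ni] := leqP i n.
  have -> : (i - n.+1 = 0)%N by lia.
  have -> : (i - n = 0)%N by lia.
  have -> : (n.+1 - i = (n - i).+1)%N by lia.
  rewrite !bin2S; congr (_ ^+ _ * _ ^+ _); lia.
have -> : (i - n = (i - n.+1).+1)%N by lia.
have -> : (n.+1 - i = 0)%N by lia.
have -> : (n - i = 0)%N by lia.
rewrite !bin2S; congr (_ ^+ _ * _ ^+ _); lia.
Qed.

(** Each new factor splits the sum in two; after an index shift a Pascal rule recombines them,
    [qbinS] when n grows and [qbinS'] when m grows. *)
Lemma finite_triple_product a b m n :
  \prod_(k < m) (1 + a * (a * b) ^+ k) * \prod_(k < n) (1 + b * (a * b) ^+ k)
  = \sum_(i < (m + n).+1) qbin (a * b) (m + n) i * theta_term a b n i.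
Proof.
(* The added boundary term F_(N+1) is zero in both uses, because it contains a Gaussian binomial
   whose lower index exceeds its upper one. *)
have shift N (F G : nat -> R) : F N.+1 = 0 ->
    \sum_(i < N.+1) (F i + G i)
    = F 0%N + \sum_(i < N.+1) (G i + F i.+1).
  move=> FN; rewrite !big_split /= addrCA [LHS]addrC; congr (_ + _).
  by rewrite big_ord_recl [in RHS]big_ord_recr /= FN addr0.
elim: m => [|m IHm].
  rewrite big_ord0 mul1r; elim: n => [|n IHn].
    by rewrite big_ord0 big_ord1 /theta_term !mul1r.
  rewrite big_ord_recr /= IHn !add0n mulr_suml.
  transitivity (\sum_(i < n.+1) ((a * b) ^+ i * qbin (a * b) n i * theta_term a b n.+1 i
      + qbin (a * b) n i * theta_term a b n.+1 i.+1)).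
    apply: eq_bigr => i _; rewrite theta_termSS mulrDr mulr1 addrC; congr (_ + _).
    by rewrite -mulrA [theta_term _ _ _ _ * _]mulrC theta_term_mulb; ring.
  rewrite (shift n (fun i => (a * b) ^+ i * qbin (a * b) n i * theta_term a b n.+1 i)
     (fun i => qbin (a * b) n i * theta_term a b n.+1 i.+1)) /=; last first.
    by rewrite qbin_small // mulr0 mul0r.
  rewrite [in RHS]big_ord_recl !qbin0 expr0 mul1r; congr (_ + _).
  by apply: eq_bigr => i _; rewrite lift0 qbinS mulrDl.
rewrite big_ord_recr /= mulrAC IHm mulr_suml addSn.
transitivity (\sum_(i < (m + n).+1) (qbin (a * b) (m + n) i * theta_term a b n i
    + (a * b) ^+ (m + n - i) * qbin (a * b) (m + n) i * theta_term a b n i.+1)).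
  apply: eq_bigr => i _; rewrite mulrDr mulr1; congr (_ + _).
  have imn : (i <= m + n)%N by rewrite -ltnS.
  transitivity (qbin (a * b) (m + n) i
    * (a * (a * b) ^+ m * theta_term a b n i)); first ring.
  by rewrite theta_term_mula //; ring.
rewrite (shift (m + n)%N (fun i => qbin (a * b) (m + n) i * theta_term a b n i)
  (fun i => (a * b) ^+ (m + n - i) * qbin (a * b) (m + n) i * theta_term a b n i.+1)) /=;
  last by rewrite qbin_small // mul0r.
rewrite [in RHS]big_ord_recl !qbin0; congr (_ + _).
apply: eq_bigr => i _; rewrite lift0 qbinS' ?mulrDl //.
by move: (ltn_ord i); lia.
Qed.

Let exprMXX (y z : R) k l e : (y ^+ k * z ^+ l) ^+ e = y ^+ (k * e) * z ^+ (l * e).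
Proof. by rewrite exprMn -!exprM. Qed.

Let bin2_double n : ('C(n.*2, 2) = 4 * 'C(n, 2) + n)%N.
Proof. by elim: n => // n IH; rewrite doubleS !bin2S IH; lia. Qed.

(** For j = 2 k, j (j + 1) / 2 = 3 k (k + 1) / 2 + k (k - 1) / 2, and j (j - 1) / 2 = k (k + 1) / 2
    + 3 k (k - 1) / 2. *)
Lemma theta_term_even a b n i :
  theta_term a b n.*2 i.*2 = theta_term (a ^+ 3 * b) (a * b ^+ 3) n i.
Proof.
(* The bare factors become first powers, the shape that [exprMXX] expects. *)
rewrite -[X in a ^+ 3 * X](expr1 b) -[X in X * b ^+ 3](expr1 a).
rewrite /theta_term -!doubleB !bin2S !bin2_double !exprMXX.
set u := 'C(_, 2); set v := 'C(_, 2).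
have mul4 e1 e2 e3 e4 : a ^+ e1 * b ^+ e2 * (a ^+ e3 * b ^+ e4)
    = a ^+ (e1 + e3) * b ^+ (e2 + e4) by rewrite !exprD; ring.
rewrite mul4; congr (_ ^+ _ * _ ^+ _); lia.
Qed.

(* f(a,b) = f(a^3 b, a b^3) + a f(a^5 b^3, b/a), with b = a c to stay in R. *)
Lemma theta_term_odd a c n i :
  theta_term a (a * c) n.*2 i.*2.+1 = a * theta_term (a ^+ 8 * c ^+ 3) c n i.
Proof.
rewrite /theta_term exprMXX exprMn.
have mul4 e1 e2 e3 : a ^+ e1 * (a ^+ e2 * c ^+ e3)
    = a ^+ (e1 + e2) * c ^+ e3 by rewrite !exprD; ring.
have mul4' e1 e2 e3 : a * (a ^+ e1 * c ^+ e2 * c ^+ e3)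
    = a ^+ e1.+1 * c ^+ (e2 + e3) by rewrite exprD exprS; ring.
rewrite mul4 mul4'.
have [ni|ni] := leqP n i.
  have -> : (i.*2.+1 - n.*2 = (i - n).*2.+1)%N by lia.
  have -> : (n.*2 - i.*2.+1 = 0)%N by lia.
  have -> : (n - i = 0)%N by lia.
  rewrite !bin2S bin2_double !bin0n; congr (_ ^+ _ * _ ^+ _); lia.
have -> : (i.*2.+1 - n.*2 = 0)%N by lia.
have -> : (n.*2 - i.*2.+1 = (n - i.+1).*2.+1)%N by lia.
have -> : (n - i = (n - i.+1).+1)%N by lia.
have -> : (i - n = 0)%N by lia.
rewrite !bin2S !bin2_double !bin0n; congr (_ ^+ _ * _ ^+ _); lia.
Qed.

End FiniteTripleProduct.

(** * The Jacobi triple product and dissection of series *)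

Section TripleProduct.
Variable R : comUnitRingType.
Implicit Types a b c x y : fps R.

Lemma eqmodX_qfact N n x : x 0%N = 0 -> (N <= n)%N ->
  eqmodX N (qpoch x x) (qfact x n).
Proof.
move=> x0 Nn; have -> : qfact x n = \prod_(k < n) (1 - x * x ^+ k).
  by apply: eq_bigr => k _; rewrite exprS.
exact: eqmodX_qpoch.
Qed.

(** The binomial is (x; x)_(k+l) over (x; x)_k (x; x)_l, and modulo q^N all three products agree
    with (x; x)_oo. *)
Lemma eqmodX_qbin N k l x : x 0%N = 0 -> (N <= k)%N -> (N <= l)%N ->
  eqmodX N (qbin x (k + l) k * qpoch x x) 1.
Proof.
move=> x0 Nk Nl; have u : qpoch x x \is a GRing.unit by apply: qpoch_unit.
rewrite -(mulrV u) -[X in X * qpoch x x](mulrK u) mulrAC.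
apply: eqmodXM => //; rewrite -mulrA.
apply: (@eqmodX_trans _ _ (qbin x (k + l) k * (qfact x k * qfact x l))).
  by apply: eqmodXM => //; apply: eqmodXM; apply: eqmodX_qfact.
by rewrite qbin_qfact; apply/eqmodX_sym/eqmodX_qfact => //; lia.
Qed.

(** With j = i - n, the exponents of a and b add up to j^2, which is at least |j| and so at least
    N. *)
Lemma eqmodX_theta_term0 N n i a b : a 0%N = 0 -> b 0%N = 0 ->
  (i + N <= n)%N || (n + N <= i)%N -> eqmodX N (theta_term a b n i) 0.
Proof.
move=> a0 b0 iN; rewrite /theta_term.
set e := (_ + _)%N; set f := (_ + _)%N.
apply: (@eqmodX_leq _ N (e + f)%N); last first.
  by apply: eqmodX_mul0; apply: eqmodX_exp0.
rewrite /e /f !bin2S; lia.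
Qed.

(* Ramanujan's f(a, b) = sum_j a^(j(j+1)/2) b^(j(j-1)/2), in product form. *)
Definition jtheta a b : fps R :=
  qpoch (- a) (a * b) * qpoch (- b) (a * b) * qpoch (a * b) (a * b).

Theorem eqmodX_jtheta N n a b : a 0%N = 0 -> b 0%N = 0 -> (N + N <= n)%N ->
  eqmodX N (jtheta a b) (\sum_(i < (n + n).+1) theta_term a b n i).
Proof.
move=> a0 b0 Nn; have x0 : (a * b) 0%N = 0 by rewrite fps_coef0M a0 mul0r.
have Nn' : (N <= n)%N by lia.
pose F := \sum_(i < (n + n).+1) qbin (a * b) (n + n) i * theta_term a b n i.
apply: (@eqmodX_trans _ _ (F * qpoch (a * b) (a * b))).
  rewrite /F -finite_triple_product; apply: eqmodXM => //.
  have e c : \prod_(k < n) (1 + c * (a * b) ^+ k)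
      = \prod_(k < n) (1 - (- c) * (a * b) ^+ k).
    by apply: eq_bigr => k _; rewrite mulNr opprK.
  by rewrite !e; apply: eqmodXM; apply: eqmodX_qpoch.
rewrite /F mulr_suml; apply: eqmodX_sum => i _.
(* Far from the centre the theta term vanishes. Near it, n >= 2 N forces both i and 2 n - i to be at
   least N, so the binomial times (a b; a b)_oo is 1. *)
have [far|near] := boolP ((i + N <= n)%N || (n + N <= i)%N).
  have z := eqmodX_theta_term0 a0 b0 far.
  apply: eqmodX_trans (eqmodX_sym z).
  by rewrite mulrAC -[X in eqmodX _ _ X](mulr0 (qbin (a * b) (n + n) i
    * qpoch (a * b) (a * b))); apply: eqmodXM.
rewrite mulrAC -[X in eqmodX _ _ X]mul1r; apply: eqmodXM => //.
case: i near => i /= ilt near.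
have -> : (n + n = i + (n + n - i))%N by lia.
by apply: eqmodX_qbin => //; move: near; rewrite negb_or; lia.
Qed.

Lemma jthetaC a b : jtheta a b = jtheta b a.
Proof. by rewrite /jtheta [b * a]mulrC [qpoch (- b) _ * _]mulrC. Qed.

(** The theta series is split into its terms of even and of odd index j. *)
Lemma jtheta_dissect a c : a 0%N = 0 -> c 0%N = 0 ->
  jtheta a (a * c) = jtheta (a ^+ 3 * (a * c)) (a * (a * c) ^+ 3)
                     + a * jtheta (a ^+ 8 * c ^+ 3) c.
Proof.
move=> a0 c0; apply: eqmodX_all => N.
have b0 : (a * c) 0%N = 0 by rewrite fps_coef0M a0 mul0r.
have [n nN] : exists n, (N + N < n)%N by exists (N + N).+1.
(* An even centre makes the parity of i that of j = i - 2 n. *)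
apply: eqmodX_trans (@eqmodX_jtheta N n.*2 _ _ a0 b0 _) _; first by lia.
have split2 M (F : nat -> fps R) :
    \sum_(i < M.*2) F i = \sum_(i < M) F i.*2 + \sum_(i < M) F i.*2.+1.
  elim: M => [|M IH]; first by rewrite !big_ord0 addr0.
  by rewrite doubleS !big_ord_recr /= IH; ring.
(* Among 0, ..., 4 n there is one more even index than odd; the last one is peeled off and joins the
   even sum. *)
rewrite big_ord_recr /= addnn split2 addrAC.
apply: eqmodXD.
  have -> : \sum_(i < n.*2) theta_term a (a * c) n.*2 i.*2
      + theta_term a (a * c) n.*2 n.*2.*2
    = \sum_(i < (n + n).+1) theta_term (a ^+ 3 * (a * c)) (a * (a * c) ^+ 3) n i.
    rewrite addnn [in RHS]big_ord_recr /= -theta_term_even; congr (_ + _).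
    by apply: eq_bigr => i _; rewrite theta_term_even.
  apply/eqmodX_sym/eqmodX_jtheta; rewrite ?fps_coef0M ?a0 ?mul0r ?mulr0 //.
  lia.
under eq_bigr do rewrite theta_term_odd.
rewrite -mulr_sumr; apply: eqmodXM => //.
apply: eqmodX_sym; apply: eqmodX_trans (@eqmodX_jtheta N n _ _ _ c0 _) _.
- by rewrite fps_coef0M [(c ^+ 3) _]fps_coefX_small ?mulr0.
- lia.
(* The odd sum lacks the top index 2 n, whose term vanishes modulo q^N. *)
rewrite big_ord_recr /= addnn -[X in eqmodX _ _ X]addr0; apply: eqmodXD => //.
apply: eqmodX_theta_term0 => //; last lia.
by rewrite fps_coef0M [(c ^+ 3) _]fps_coefX_small ?mulr0.
Qed.

Lemma fps_comp_jtheta x a b : x 0%N = 0 -> a 0%N = 0 ->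
  fps_comp x (jtheta a b) = jtheta (fps_comp x a) (fps_comp x b).
Proof.
move=> x0 a0; have ab0 : (a * b) 0%N = 0 by rewrite fps_coef0M a0 mul0r.
pose Q c := qpoch c (a * b).
have QE c : fps_comp x (Q c) = qpoch (fps_comp x c) (fps_comp x (a * b)).
  by rewrite (fps_comp_qpoch c x0 ab0).
rewrite -[jtheta a b]/(Q (- a) * Q (- b) * Q (a * b)).
rewrite (fps_compM (Q (- a) * Q (- b)) _ x0) (fps_compM (Q (- a)) _ x0) !QE.
by rewrite !fps_compN (fps_compM a b x0).
Qed.

Lemma qpoch_split2 a x : x 0%N = 0 ->
  qpoch a x = qpoch a (x ^+ 2) * qpoch (a * x) (x ^+ 2).
Proof.
move=> x0; rewrite (@qpoch_split _ 2 a x) // big_ord_recl big_ord1.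
by rewrite expr0 mulr1 expr1.
Qed.

Lemma qpoch_split3 a x : x 0%N = 0 ->
  qpoch a x = qpoch a (x ^+ 3) * qpoch (a * x) (x ^+ 3)
              * qpoch (a * x ^+ 2) (x ^+ 3).
Proof.
move=> x0; rewrite (@qpoch_split _ 3 a x) // !big_ord_recl big_ord0.
by rewrite expr0 mulr1 expr1 mulr1 mulrA.
Qed.

(** Split (x; x)_oo and (-x; -x)_oo along x^2: their odd parts multiply to (x^2; x^4)_oo, which
    (x^4; x^4)_oo completes to (x^2; x^2)_oo. This evaluates f_r(-q) for odd r. *)
Lemma qpoch_negX x : x 0%N = 0 ->
  qpoch x x * qpoch (- x) (- x) * qpoch (x ^+ 4) (x ^+ 4)
  = qpoch (x ^+ 2) (x ^+ 2) ^+ 3.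
Proof.
move=> x0; have x20 : (x ^+ 2) 0%N = 0 by rewrite fps_coefX_small.
have nx0 : (- x) 0%N = 0 by rewrite fps_coefN x0 oppr0.
have nxx : (- x) ^+ 2 = x ^+ 2 by rewrite sqrrN.
have h1 := qpoch_split2 x x0; have h2 := qpoch_split2 (- x) nx0.
have h3 := qpoch_split2 (x ^+ 2) x20; have h4 := qpochN x x20.
rewrite mulrNN nxx -expr2 in h2; rewrite -expr2 in h1.
rewrite -expr2 -!exprM in h3; rewrite -!exprM in h4.
move: h1 h2 h3 h4; rewrite [(2 * 2)%N]/=.
move: (qpoch (x ^+ 2) (x ^+ 2)) (qpoch x (x ^+ 2)) (qpoch (- x) (x ^+ 2)).
move: (qpoch (x ^+ 2) (x ^+ 4)) (qpoch (x ^+ 4) (x ^+ 4)) => g f4 f2 o no.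
by move=> -> -> -> <-; ring.
Qed.

Lemma coef_dissect k r s c n : (r < k)%N -> (s < k)%N ->
  (fps_X R ^+ r * fps_comp (fps_X R ^+ k) c) (k * n + s)%N = c n *+ (r == s)%N.
Proof.
move=> rk sk; have [rs|sr] := leqP r s.
  rewrite -(subnK rs) addnA fps_coefXnM fps_comp_coefXn; last by lia.
  by rewrite (subnK rs) subn_eq0 eqn_leq rs.
have -> : (r == s) = false by apply/negbTE; lia.
(* As r > s, reaching k n + s - r needs a borrow from n. For n = 0 the index lies below r; otherwise
   the remainder k + s - r is nonzero modulo k. *)
case: n => [|n].
  rewrite muln0 add0n mulrC fps_coefM big1 // => i _.
  rewrite fps_coefXn; have -> : (s - i == r)%N = false by apply/negbTE; lia.
  by rewrite mulr0.
have -> : (k * n.+1 + s = k * n + (k + s - r) + r)%N by lia.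
rewrite fps_coefXnM fps_comp_coefXn; last by lia.
by have -> : (k + s - r == 0)%N = false by apply/negbTE; lia.
Qed.

Lemma coef_sum_dissect k (c : nat -> fps R) s n : (s < k)%N ->
  (\sum_(r < k) fps_X R ^+ r * fps_comp (fps_X R ^+ k) (c r)) (k * n + s)%N = c s n.
Proof.
move=> sk; rewrite fps_coef_sum (bigD1 (Ordinal sk)) // coef_dissect // eqxx.
rewrite mulr1n big1 => [|i isk]; [exact: addr0 | rewrite coef_dissect //].
suff -> : (nat_of_ord i == s) = false by rewrite mulr0n.
by apply/negbTE; apply: contra isk => /eqP e; apply/eqP/val_inj.
Qed.

End TripleProduct.

Lemma jthetaE (R : comUnitRingType) (a b x : fps R) : a * b = x ->
  jtheta a b = qpoch (- a) x * qpoch (- b) x * qpoch x x.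
Proof. by move=> <-. Qed.

(** The case a = -x, c = x^4 of [jtheta_dissect]. *)
Lemma jtheta_dissect_1_5 (R : comUnitRingType) (x : fps R) : x 0%N = 0 ->
  jtheta (- x) (- x ^+ 5)
  = jtheta (x ^+ 8) (x ^+ 16) - x * jtheta (x ^+ 4) (x ^+ 20).
Proof.
move=> x0; have nx0 : (- x) 0%N = 0 by rewrite fps_coefN x0 oppr0.
have x40 : (x ^+ 4) 0%N = 0 by rewrite fps_coefX_small.
have := jtheta_dissect nx0 x40.
have -> : - x * x ^+ 4 = - x ^+ 5 by ring.
have -> : (- x) ^+ 3 * - x ^+ 5 = x ^+ 8 by ring.
have -> : - x * (- x ^+ 5) ^+ 3 = x ^+ 16 by ring.
have -> : (- x) ^+ 8 * (x ^+ 4) ^+ 3 = x ^+ 20 by ring.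
by rewrite [jtheta (x ^+ 20) _]jthetaC (mulNr x (jtheta _ _)).
Qed.

(** * Theta functions as quotients of Euler products *)

Section EulerProducts.
Variable R : comUnitRingType.
Local Notation X := (fps_X R).
Local Notation f := (euler_f R).

Lemma fps_Xn0 k : (0 < k)%N -> (X ^+ k) 0%N = 0.
Proof. exact: fps_coefX_small. Qed.

Lemma fps_NX0 : (- X) 0%N = 0.
Proof. by rewrite fps_coefN /= oppr0. Qed.

Lemma fps_comp_X k m : (0 < k)%N -> fps_comp (X ^+ k) (X ^+ m) = X ^+ (k * m).
Proof. by move=> k0; rewrite fps_compXn ?fps_compX ?fps_Xn0 // exprM. Qed.

Lemma fps_comp_NX m : fps_comp (- X) (X ^+ m) = (-1) ^+ m * X ^+ m.
Proof. by rewrite fps_compXn ?fps_compX ?fps_NX0 // [LHS]exprNn. Qed.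

Lemma fps_comp_NXe m : ~~ odd m -> fps_comp (- X) (X ^+ m) = X ^+ m.
Proof. by move=> em; rewrite fps_comp_NX -signr_odd (negbTE em) mul1r. Qed.

Lemma fps_comp_euler k r : (0 < k)%N -> (0 < r)%N ->
  fps_comp (X ^+ k) (f r) = f (k * r).
Proof. by move=> k0 r0; rewrite fps_comp_qpoch ?fps_Xn0 ?fps_comp_X. Qed.

Lemma fps_compN_euler_even r : (0 < r)%N -> ~~ odd r ->
  fps_comp (- X) (f r) = f r.
Proof.
move=> r0 er; rewrite (fps_comp_qpoch _ fps_NX0 (fps_Xn0 r0)).
by rewrite (fps_comp_NXe er).
Qed.

Lemma fps_compN_euler_odd r : odd r ->
  f r * fps_comp (- X) (f r) * f (r * 4) = f (r * 2) ^+ 3.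
Proof.
move=> ro; have r0 : (0 < r)%N by case: r ro.
rewrite (fps_comp_qpoch _ fps_NX0 (fps_Xn0 r0)) fps_comp_NX.
rewrite -signr_odd ro expr1 mulN1r /euler_f !exprM.
exact: qpoch_negX (fps_Xn0 r0).
Qed.

(* schurA, thetaP k and thetaQ k are A, P(q^k) and Q(q^k). *)
Definition schurA : fps R :=
  qpoch X (X ^+ 6) * qpoch (X ^+ 5) (X ^+ 6) * qpoch (X ^+ 6) (X ^+ 6).
Definition thetaP k : fps R := jtheta (X ^+ (k * 2)) (X ^+ (k * 4)).
Definition thetaQ k : fps R := jtheta (X ^+ k) (X ^+ (k * 5)).

Lemma schurA_jtheta : schurA = jtheta (- X) (- X ^+ 5).
Proof. by rewrite /jtheta mulrNN -exprS !opprK. Qed.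

Lemma schurA_dissect : schurA = thetaP 4 - X * thetaQ 4.
Proof.
by rewrite schurA_jtheta (jtheta_dissect_1_5 (fps_Xn0 (isT : 0 < 1)%N)).
Qed.

Lemma fps_comp_thetaP m k : (0 < m)%N -> (0 < k)%N ->
  fps_comp (X ^+ m) (thetaP k) = thetaP (m * k).
Proof.
move=> m0 k0; have k20 : (0 < k * 2)%N by rewrite muln_gt0 k0.
rewrite /thetaP (fps_comp_jtheta _ (fps_Xn0 m0) (fps_Xn0 k20)).
by rewrite (fps_comp_X _ m0) (fps_comp_X _ m0) -!mulnA.
Qed.

Lemma fps_comp_thetaQ m k : (0 < m)%N -> (0 < k)%N ->
  fps_comp (X ^+ m) (thetaQ k) = thetaQ (m * k).
Proof.
move=> m0 k0; rewrite /thetaQ (fps_comp_jtheta _ (fps_Xn0 m0) (fps_Xn0 k0)).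
by rewrite (fps_comp_X _ m0) (fps_comp_X _ m0) -!mulnA.
Qed.

Lemma fps_compN_thetaP k : (0 < k)%N -> fps_comp (- X) (thetaP k) = thetaP k.
Proof.
move=> k0; have k20 : (0 < k * 2)%N by rewrite muln_gt0 k0.
rewrite /thetaP (fps_comp_jtheta _ fps_NX0 (fps_Xn0 k20)) !fps_comp_NXe //;
  by rewrite oddM andbF.
Qed.

Lemma fps_compN_thetaQ k : (0 < k)%N -> ~~ odd k ->
  fps_comp (- X) (thetaQ k) = thetaQ k.
Proof.
move=> k0 ek; rewrite /thetaQ (fps_comp_jtheta _ fps_NX0 (fps_Xn0 k0)).
by rewrite !fps_comp_NXe // oddM (negbTE ek).
Qed.

Lemma fps_compN_schurA : fps_comp (- X) schurA = thetaQ 1.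
Proof.
have NX : fps_comp (- X) (- X) = X.
  by rewrite fps_compN (fps_compX fps_NX0) opprK.
have NX5 : fps_comp (- X) (- X ^+ 5) = X ^+ 5.
  by rewrite fps_compN fps_comp_NX -signr_odd expr1 mulN1r opprK.
by rewrite schurA_jtheta (fps_comp_jtheta _ fps_NX0 fps_NX0) NX NX5.
Qed.

(** Here and below, Euler products are cut into residue classes modulo 6 or 12, so that
    [schurA_euler] and [thetaP_euler] become ring identities in the pieces. *)
Let f1E : f 1 = qpoch X (X ^+ 6) * qpoch (X ^+ 3) (X ^+ 6)
  * qpoch (X ^+ 5) (X ^+ 6) * f 2.
Proof.
have h1 := qpoch_split2 X (fps_Xn0 (isT : 0 < 1)%N).
have h2 := qpoch_split3 X (fps_Xn0 (isT : 0 < 2)%N).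
rewrite -!exprM -!exprS in h2; rewrite -expr2 h2 in h1.
exact: h1.
Qed.

Let f2E : f 2 = qpoch (X ^+ 2) (X ^+ 6) * qpoch (X ^+ 4) (X ^+ 6) * f 6.
Proof.
have := qpoch_split3 (X ^+ 2) (fps_Xn0 (isT : 0 < 2)%N).
by rewrite -!exprM -!exprD.
Qed.

Let f3E : f 3 = qpoch (X ^+ 3) (X ^+ 6) * f 6.
Proof.
have := qpoch_split2 (X ^+ 3) (fps_Xn0 (isT : 0 < 3)%N).
by rewrite -!exprM -!exprD.
Qed.

Let f4E : f 4 = qpoch (X ^+ 4) (X ^+ 12) * qpoch (X ^+ 8) (X ^+ 12) * f 12.
Proof.
have := qpoch_split3 (X ^+ 4) (fps_Xn0 (isT : 0 < 4)%N).
by rewrite -!exprM -!exprD.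
Qed.

Lemma schurA_euler : schurA * f 2 * f 3 = f 1 * f 6 ^+ 2.
Proof.
rewrite f1E f2E f3E -[schurA]/(qpoch X (X ^+ 6) * qpoch (X ^+ 5) (X ^+ 6) * f 6).
move: (f 6) (qpoch X _) (qpoch (X ^+ 2) _) (qpoch (X ^+ 3) _) (qpoch (X ^+ 4) _)
   (qpoch (X ^+ 5) _) => *; ring.
Qed.

Lemma thetaP_euler : thetaP 1 * f 2 * f 12 = f 4 * f 6 ^+ 2.
Proof.
(* The factors of P with a plus sign are traded for pieces of f_2 and f_4. *)
have h2 : qpoch (X ^+ 2) (X ^+ 6) * qpoch (- X ^+ 2) (X ^+ 6)
    = qpoch (X ^+ 4) (X ^+ 12).
  have := qpochN (X ^+ 2) (fps_Xn0 (isT : 0 < 6)%N).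
  by rewrite -!exprM.
have h4 : qpoch (X ^+ 4) (X ^+ 6) * qpoch (- X ^+ 4) (X ^+ 6)
    = qpoch (X ^+ 8) (X ^+ 12).
  have := qpochN (X ^+ 4) (fps_Xn0 (isT : 0 < 6)%N).
  by rewrite -!exprM.
have -> : thetaP 1 = qpoch (- X ^+ 2) (X ^+ 6) * qpoch (- X ^+ 4) (X ^+ 6) * f 6.
  by apply: jthetaE; rewrite -exprD.
rewrite f2E f4E -h2 -h4.
move: (f 6) (f 12) (qpoch (X ^+ 2) _) (qpoch (X ^+ 4) _)
  (qpoch (- X ^+ 2) _) (qpoch (- X ^+ 4) _) => *; ring.
Qed.

End EulerProducts.

(** * The denominator D and the 4-dissection of 1 / A *)

Lemma geometric4_inv (S : comUnitRingType) (p q x w : S) :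
  (p ^+ 4 - x ^+ 4 * q ^+ 4) * w = 1 ->
  (p - x * q)^-1 = \sum_(r < 4) x ^+ r * (p ^+ (3 - r) * q ^+ r * w).
Proof.
move=> h.
(* The finite geometric sum: p - x q divides p^4 - (x q)^4 with this cofactor. *)
have e : (p - x * q) * (\sum_(r < 4) x ^+ r * (p ^+ (3 - r) * q ^+ r * w)) = 1.
  by rewrite -h !big_ord_recl big_ord0 /bump /=; ring.
have u : p - x * q \is a GRing.unit by apply/unitrPr; eexists; exact: e.
by apply: (mulrI u); rewrite e mulrV.
Qed.

Section Dissection.
Variable R : comUnitRingType.
Local Notation X := (fps_X R).
Local Notation f := (euler_f R).
Local Notation A := (schurA R).
Local Notation P := (thetaP R).
Local Notation Q := (thetaQ R).
Local Notation neg := (fps_comp (- X)).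

Let neg_f1 : f 1 * neg (f 1) * f 4 = f 2 ^+ 3.
Proof. exact: (@fps_compN_euler_odd R 1). Qed.

Let neg_f3 : f 3 * neg (f 3) * f 12 = f 6 ^+ 3.
Proof. exact: (@fps_compN_euler_odd R 3). Qed.

Let neg_f2 : neg (f 2) = f 2. Proof. exact: fps_compN_euler_even. Qed.
Let neg_f6 : neg (f 6) = f 6. Proof. exact: fps_compN_euler_even. Qed.

Let negM a b : neg (a * b) = neg a * neg b.
Proof. exact: fps_compM (fps_NX0 R). Qed.

Let comp2M a b :
  fps_comp (X ^+ 2) (a * b) = fps_comp (X ^+ 2) a * fps_comp (X ^+ 2) b.
Proof. exact: fps_compM (fps_Xn0 R (isT : 0 < 2)%N). Qed.

(* Stated on variables because rewriting under the infinite products would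
   unfold them. *)
Let neg_eq3 a b c d e a' b' e' : neg a = a' -> neg b = b' -> neg e = e' ->
  a * b * c = d * e ^+ 2 -> a' * b' * neg c = neg d * e' ^+ 2.
Proof. by move=> <- <- <- /(congr1 neg); rewrite !expr2 !negM. Qed.

(** Since Q = A(-q), replace q by -q in [schurA_euler] and eliminate f_1(-q) and f_3(-q). *)
Lemma thetaQ_euler : Q 1 * f 1 * f 4 * f 6 = f 2 ^+ 2 * f 3 * f 12.
Proof.
have h := neg_eq3 (fps_compN_schurA R) neg_f2 neg_f6 (schurA_euler R).
have u2 := @euler_f_unit R 2 isT; have u6 := @euler_f_unit R 6 isT.
move: h neg_f1 neg_f3 u2 u6.
move: (Q 1) (neg (f 1)) (neg (f 3)) => q n1 n3.
move: (f 1) (f 2) (f 3) (f 4) (f 6) (f 12) => f1 f2 f3 f4 f6 f12 h e1 e3 u2 u6.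
(* Multiplying by f_2 f_6^2 creates the f_6^3 that [e3] rewrites and the q f_2 n_3 that [h]
   rewrites. *)
apply: (mulIr u2); apply: (mulIr u6); apply: (mulIr u6).
transitivity (q * f2 * f1 * f4 * f6 ^+ 3); first ring.
rewrite -e3; transitivity (q * f2 * n3 * f1 * f4 * f3 * f12); first ring.
rewrite h; transitivity (f1 * n1 * f4 * f6 ^+ 2 * f3 * f12); first ring.
rewrite e1; ring.
Qed.

Lemma schurA_mul_neg : A * Q 1 * f 4 = f 2 * f 6 * f 12.
Proof.
have u1 := @euler_f_unit R 1 isT; have u2 := @euler_f_unit R 2 isT.
have u3 := @euler_f_unit R 3 isT; have u6 := @euler_f_unit R 6 isT.
move: (schurA_euler R) thetaQ_euler u1 u2 u3 u6.
move: A (Q 1) (f 1) (f 2) (f 3) (f 4) (f 6) (f 12).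
move=> a q f1 f2 f3 f4 f6 f12 hA hQ u1 u2 u3 u6.
apply: (mulIr u1); apply: (mulIr u2); apply: (mulIr u3); apply: (mulIr u6).
transitivity ((a * f2 * f3) * (q * f1 * f4 * f6)); first ring.
rewrite hA hQ; ring.
Qed.

Let B : fps R := P 2 ^+ 2 - X * Q 2 ^+ 2.

Let negX : neg X = - X.
Proof. exact: fps_compX (fps_NX0 R). Qed.

Let negP k : (0 < k)%N -> neg (P k) = P k.
Proof. exact: fps_compN_thetaP. Qed.

Let negQ k : (0 < k)%N -> ~~ odd k -> neg (Q k) = Q k.
Proof. exact: fps_compN_thetaQ. Qed.

Let comp2P k : (0 < k)%N -> fps_comp (X ^+ 2) (P k) = P (2 * k).
Proof. exact: fps_comp_thetaP. Qed.

Let comp2Q k : (0 < k)%N -> fps_comp (X ^+ 2) (Q k) = Q (2 * k).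
Proof. exact: fps_comp_thetaQ. Qed.

Let negB p q : neg p = p -> neg q = q -> neg (p - X * q) = p + X * q.
Proof. by move=> hp hq; rewrite fps_compB negM negX hp hq mulNr opprK. Qed.

Let neg_sqr p : neg p = p -> neg (p ^+ 2) = p ^+ 2.
Proof. by move=> hp; rewrite expr2 negM hp. Qed.

Let comp_subX m p q p' q' k : (0 < m)%N ->
  fps_comp (X ^+ m) p = p' -> fps_comp (X ^+ m) q = q' ->
  fps_comp (X ^+ m) (p ^+ k - X * q ^+ k) = p' ^+ k - X ^+ m * q' ^+ k.
Proof.
move=> m0 <- <-; have Xm0 := fps_Xn0 R m0.
by rewrite fps_compB (fps_compM _ _ Xm0) (fps_compX Xm0) !(fps_compXn _ _ Xm0).
Qed.

(** A difference of squares: A = P(q^4) - q Q(q^4), and A(-q) has the opposite sign. *)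
Let comp2B : fps_comp (X ^+ 2) B = A * Q 1.
Proof.
have hQ : Q 1 = P 4 + X * Q 4.
  apply: etrans (esym (fps_compN_schurA R)) _.
  apply: etrans (congr1 neg (schurA_dissect R)) _.
  exact: negB (negP (isT : 0 < 4)%N) (negQ (isT : 0 < 4)%N isT).
apply: etrans (comp_subX 2 (isT : 0 < 2)%N
  (comp2P (isT : 0 < 2)%N) (comp2Q (isT : 0 < 2)%N)) _.
rewrite hQ (schurA_dissect R).
change (2 * 2)%N with 4%N.
move: (P 4) (Q 4) X => p q x; ring.
Qed.

Let comp2_eq b f2 f1 f3 f6 b' f2' f1' f3' f6' :
  fps_comp (X ^+ 2) b = b' -> fps_comp (X ^+ 2) f2 = f2' ->
  fps_comp (X ^+ 2) f1 = f1' -> fps_comp (X ^+ 2) f3 = f3' ->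
  fps_comp (X ^+ 2) f6 = f6' -> b' * f2' = f1' * f3' * f6' -> b * f2 = f1 * f3 * f6.
Proof.
move=> <- <- <- <- <- e; apply: (@fps_comp_Xn_inj R 2 isT).
by rewrite !comp2M.
Qed.

Let comp2f r : (0 < r)%N -> fps_comp (X ^+ 2) (f r) = f (2 * r).
Proof. exact: fps_comp_euler. Qed.

(** Every factor of [schurA_mul_neg], with A Q grouped as B(q^2), is a series in q^2; all exponents
    are halved. *)
Let B_euler : B * f 2 = f 1 * f 3 * f 6.
Proof.
exact: comp2_eq comp2B (comp2f (isT : 0 < 2)%N) (comp2f (isT : 0 < 1)%N)
  (comp2f (isT : 0 < 3)%N) (comp2f (isT : 0 < 6)%N) schurA_mul_neg.
Qed.

Definition dissect_den : fps R := P 1 ^+ 4 - X * Q 1 ^+ 4.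

Let comp2D : fps_comp (X ^+ 2) dissect_den = B * neg B.
Proof.
have -> : neg B = P 2 ^+ 2 + X * Q 2 ^+ 2.
  by apply: negB; apply: neg_sqr; [apply: negP | apply: negQ].
apply: etrans (comp_subX 4 (isT : 0 < 2)%N
  (comp2P (isT : 0 < 1)%N) (comp2Q (isT : 0 < 1)%N)) _.
rewrite /B; change (2 * 1)%N with 2%N.
move: (P 2) (Q 2) X => p q x; ring.
Qed.

Let neg_eqB b f1 f2 f3 f6 : neg f2 = f2 -> neg f6 = f6 ->
  b * f2 = f1 * f3 * f6 -> neg b * f2 = neg f1 * neg f3 * f6.
Proof. by move=> h2 h6 /(congr1 neg); rewrite !negM h2 h6. Qed.

Let mul_negB (b nb n1 n3 f1 f2 f3 f4 f6 f12 : fps R) : f2 \is a GRing.unit ->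
  b * f2 = f1 * f3 * f6 -> nb * f2 = n1 * n3 * f6 ->
  f1 * n1 * f4 = f2 ^+ 3 -> f3 * n3 * f12 = f6 ^+ 3 ->
  b * nb * f4 * f12 = f2 * f6 ^+ 5.
Proof.
move=> u2 hb hn e1 e3; apply: (mulIr u2); apply: (mulIr u2).
transitivity ((b * f2) * (nb * f2) * f4 * f12); first ring.
rewrite hb hn; transitivity ((f1 * n1 * f4) * (f3 * n3 * f12) * f6 ^+ 2).
  ring.
rewrite e1 e3; ring.
Qed.

(** The same descent from q^2 to q, applied to the value of B(q) B(-q) = D(q^2). *)
Lemma dissect_den_euler : dissect_den * f 2 * f 6 = f 1 * f 3 ^+ 5.
Proof.
have h := mul_negB (@euler_f_unit R 2 isT) B_euler
  (neg_eqB neg_f2 neg_f6 B_euler) neg_f1 neg_f3.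
have e3 : fps_comp (X ^+ 2) (f 3 ^+ 5) = f 6 ^+ 5.
  rewrite (fps_compXn _ _ (fps_Xn0 R (isT : 0 < 2)%N)); congr (_ ^+ 5).
  exact: comp2f.
(* The grouping and the factor 1 give the shape that [comp2_eq] requires. *)
have h' : B * neg B * (f 4 * f 12) = f 2 * f 6 ^+ 5 * 1 by rewrite mulrA mulr1.
have e26 : fps_comp (X ^+ 2) (f 2 * f 6) = f 4 * f 12.
  by apply: etrans (comp2M _ _) _; congr (_ * _); apply: comp2f.
have := comp2_eq comp2D e26 (comp2f (isT : 0 < 1)%N) e3 (fps_comp1 (X ^+ 2)) h'.
by rewrite mulr1 mulrA.
Qed.

(** D divides the unit f_1 f_3^5. *)
Lemma dissect_den_unit : dissect_den \is a GRing.unit.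
Proof.
have : f 1 * f 3 ^+ 5 \is a GRing.unit.
  by rewrite unitrM (unitrX 5 (@euler_f_unit R 3 isT)) (@euler_f_unit R 1 isT).
by rewrite -dissect_den_euler !unitrM => /andP[/andP[]].
Qed.

Let comp4M a b :
  fps_comp (X ^+ 4) (a * b) = fps_comp (X ^+ 4) a * fps_comp (X ^+ 4) b.
Proof. exact: fps_compM (fps_Xn0 R (isT : 0 < 4)%N). Qed.

Let comp4_term p q w p' q' i j :
  fps_comp (X ^+ 4) p = p' -> fps_comp (X ^+ 4) q = q' ->
  fps_comp (X ^+ 4) (p ^+ i * q ^+ j * w) = p' ^+ i * q' ^+ j * fps_comp (X ^+ 4) w.
Proof.
move=> <- <-; rewrite !comp4M.
by rewrite !(fps_compXn _ _ (fps_Xn0 R (isT : 0 < 4)%N)).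
Qed.

Lemma schurA_inv : A^-1 = \sum_(r < 4) X ^+ r
  * fps_comp (X ^+ 4) (P 1 ^+ (3 - r) * Q 1 ^+ r / dissect_den).
Proof.
have hP : fps_comp (X ^+ 4) (P 1) = P 4 by exact: fps_comp_thetaP.
have hQ : fps_comp (X ^+ 4) (Q 1) = Q 4 by exact: fps_comp_thetaQ.
have hD : fps_comp (X ^+ 4) dissect_den * fps_comp (X ^+ 4) dissect_den^-1 = 1.
  by rewrite -comp4M (mulrV dissect_den_unit) fps_comp1.
have {}hD : (P 4 ^+ 4 - X ^+ 4 * Q 4 ^+ 4) * fps_comp (X ^+ 4) dissect_den^-1 = 1.
  exact: etrans (congr1 (fun z => z * _)
    (esym (comp_subX 4 (isT : 0 < 4)%N hP hQ))) hD.
have term (r : 'I_4) : X ^+ r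
    * fps_comp (X ^+ 4) (P 1 ^+ (3 - r) * Q 1 ^+ r / dissect_den)
    = X ^+ r * (P 4 ^+ (3 - r) * Q 4 ^+ r * fps_comp (X ^+ 4) dissect_den^-1).
  by congr (_ * _); apply: comp4_term.
rewrite (eq_bigr _ (fun r _ => term r)) {term}.
move: (fps_comp (X ^+ 4) dissect_den^-1) hD => w hD.
rewrite (schurA_dissect R); move: (P 4) (Q 4) X hD => p q x hD.
exact: geometric4_inv.
Qed.

Lemma schurA_inv_coef s n : (s < 4)%N ->
  A^-1 (4 * n + s)%N = (P 1 ^+ (3 - s) * Q 1 ^+ s / dissect_den) n.
Proof.
move=> s4; rewrite schurA_inv.
exact: (coef_sum_dissect (fun r => P 1 ^+ (3 - r) * Q 1 ^+ r / dissect_den) n s4).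
Qed.

End Dissection.

(** * Simplification to the four quotients *)

Lemma divr_eq_div (S : comUnitRingType) (u v y z : S) :
  v \is a GRing.unit -> z \is a GRing.unit -> u * z = y * v -> u / v = y / z.
Proof.
by move=> uv uz e; apply: (mulIr uv); rewrite divrK // mulrAC -e mulrK.
Qed.

Lemma eta_quotients (S : comUnitRingType) (f1 f2 f3 f4 f6 f12 P Q D : S) :
  f1 \is a GRing.unit -> f2 \is a GRing.unit -> f3 \is a GRing.unit ->
  f4 \is a GRing.unit -> f6 \is a GRing.unit -> f12 \is a GRing.unit ->
  P * f2 * f12 = f4 * f6 ^+ 2 -> Q * f1 * f4 * f6 = f2 ^+ 2 * f3 * f12 ->
  D * f2 * f6 = f1 * f3 ^+ 5 -> D \is a GRing.unit ->
  [/\ P ^+ (3 - 0) * Q ^+ 0 / D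
        = (f4 ^+ 3 * f6 ^+ 7) / (f1 * f2 ^+ 2 * f3 ^+ 5 * f12 ^+ 3),
      P ^+ (3 - 1) * Q ^+ 1 / D
        = (f2 * f4 * f6 ^+ 4) / (f1 ^+ 2 * f3 ^+ 4 * f12),
      P ^+ (3 - 2) * Q ^+ 2 / D
        = (f2 ^+ 4 * f6 * f12) / (f1 ^+ 3 * f3 ^+ 3 * f4)
    & P ^+ (3 - 3) * Q ^+ 3 / D
        = (f2 ^+ 7 * f12 ^+ 3) / (f1 ^+ 4 * f3 ^+ 2 * f4 ^+ 3 * f6 ^+ 2)].
Proof.
move=> u1 u2 u3 u4 u6 u12 hP hQ hD uD.
(* Substitutes P = f4 f6^2 / (f2 f12), Q = f2^2 f3 f12 / (f1 f4 f6) and 1 / D = f2 f6 / (f1 f3^5),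
   uniformly in i and j. *)
have quot i j : P ^+ i * Q ^+ j / D
    = ((f4 * f6 ^+ 2) ^+ i * (f2 ^+ 2 * f3 * f12) ^+ j * (f2 * f6))
      / ((f2 * f12) ^+ i * (f1 * f4 * f6) ^+ j * (f1 * f3 ^+ 5)).
  apply: divr_eq_div => //.
    by rewrite !unitrM !unitrX ?unitrM ?u1 ?u2 ?u3 ?u4 ?u6 ?u12.
  by rewrite -hP -hQ -hD !exprMn; ring.
split; rewrite quot; apply: divr_eq_div.
all: try by rewrite !unitrM ?unitrX ?unitrM ?u1 ?u2 ?u3 ?u4 ?u6 ?u12.
all: ring.
Qed.

Theorem theorem3p2 :
  [/\ FPS (fun n => overS (4 * n)) =
        ('f_4 ^+ 3 * 'f_6 ^+ 7)
        / ('f_1 * 'f_2 ^+ 2 * 'f_3 ^+ 5 * 'f_12 ^+ 3),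
      FPS (fun n => overS (4 * n + 1)) =
        ('f_2 * 'f_4 * 'f_6 ^+ 4)
        / ('f_1 ^+ 2 * 'f_3 ^+ 4 * 'f_12),
      FPS (fun n => overS (4 * n + 2)) =
        ('f_2 ^+ 4 * 'f_6 * 'f_12)
        / ('f_1 ^+ 3 * 'f_3 ^+ 3 * 'f_4)
    & FPS (fun n => overS (4 * n + 3)) =
        ('f_2 ^+ 7 * 'f_12 ^+ 3)
        / ('f_1 ^+ 4 * 'f_3 ^+ 2 * 'f_4 ^+ 3 * 'f_6 ^+ 2)].
Proof.
have S s : (s < 4)%N -> FPS (fun n => overS (4 * n + s))
    = thetaP int 1 ^+ (3 - s) * thetaQ int 1 ^+ s / dissect_den int.
  by move=> s4; apply/fpsP => n; exact: schurA_inv_coef.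
have -> : FPS (fun n => overS (4 * n)) = FPS (fun n => overS (4 * n + 0)).
  by apply/fpsP => n /=; rewrite addn0.
rewrite (S 0%N isT) (S 1%N isT) (S 2%N isT) (S 3%N isT) {S}.
have uf r : (0 < r)%N -> 'f_r \is a GRing.unit by exact: euler_f_unit.
move: (thetaP_euler int) (thetaQ_euler int) (dissect_den_euler int) (dissect_den_unit int).
move: (uf 1 isT) (uf 2 isT) (uf 3 isT) (uf 4 isT) (uf 6 isT) (uf 12 isT).
move: {uf} (thetaP int 1) (thetaQ int 1) (dissect_den int).
(* Only the three product relations and invertibility matter from here on, so all series become
   variables. *)
move: 'f_1 'f_2 'f_3 'f_4 'f_6 'f_12 => f1 f2 f3 f4 f6 f12 P Q D.
exact: eta_quotients.
Qed.
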